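(* Let $G=(V,E)$ be a simple undirected graph with $V=[n]$, let $N=\binom{n}{2}$, and let $\mathcal P_n=\{(i,j)\in V\times V: i<j\}$ be enumerated as $(i_k,j_k)$, $k\in[N]$. Let $\sigma^*$ be a permutation of $[n]$ and $y_k=\operatorname{sign}(\sigma^*(i_k)-\sigma^*(j_k))\in\{\pm1\}$. Let $\tilde U=[\tilde u_1,\dots,\tilde u_N]\in\mathbb R^{d\times N}$ be any pairwise embedding and fix $C>0$. Fix $f\in(0,1/2]$, let $m=m(f)=\lceil Nf\rceil$, and let $S=S_{m(f)}\subseteq\mathcal P_n$ be a subset of size $m$ drawn uniformly at random among all subsets of $\mathcal P_n$ of size $m$, with labels $\{y_k\}_{k\in S}$ revealed; let $\bar S=\mathcal P_n\setminus S$. Let $\mathcal H_{\tilde U}=\{w\mid w=\tilde U\beta,\ \beta\in\mathbb R^N,\ \|\beta\|_\infty\le C\}$ and let $\ell^\rho:\{\pm1\}\times\mathbb R\to[0,B]$ be a bounded loss which is $\rho$-Lipschitz in its second argument, i.e. $|\ell^\rho(y,a)-\ell^\rho(y,a')|\le\frac1\rho|a-a'|$. Let $f^*=\tilde U^\top w^*\in\mathbb R^N$ be the pairwise score vector output by Pref-Rank on $(\tilde U,S,\{y_k\}_{k\in S})$. Then there is a constant $C_1>0$ such that for any $\delta>0$, with probability at least $1-\delta$ over the draw of $S$, $$er^{\ell^\rho}_{\bar S}(f^* )\le er^{\ell^\rho}_{S}(f^* )+\frac{R(\mathcal H_{\tilde U},\tilde U,p)}{\rho f(1-f)}+\frac{C_1B\sqrt{\ln(1/\delta)}}{(1-f)\sqrt{Nf}},$$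 where $p=f(1-f)$.
   Context: Pref-Rank with embedding $\tilde U$ and regularization parameter $C>0$: compute $w^*\in\arg\min_{w\in\mathbb R^d}\frac12\|w\|_2^2+C\sum_{k\in S}\max(0,1-y_kw^\top\tilde u_k)$ and output the pairwise scores $f^*=\tilde U^\top w^*$ (so $f^*_k=w^{*\top}\tilde u_k$). (By SVM duality $w^*=\tilde U\beta$ with $\beta_k=y_k\alpha_k$ for $k\in S$, $\beta_k=0$ otherwise, and $\|\beta\|_\infty\le C$.) For a loss $\ell$ and score vector $g\in\mathbb R^N$, $er^\ell_S(g)=\frac1{|S|}\sum_{k\in S}\ell(y_k,g_k)$ and $er^\ell_{\bar S}(g)=\frac1{|\bar S|}\sum_{k\in\bar S}\ell(y_k,g_k)$. Transductive Rademacher complexity: for a class $\mathcal H$ of vectors $h\in\mathbb R^d$ and $p\in(0,1/2]$, $R(\mathcal H,\tilde U,p)=\frac1N\mathbb E_\gamma\big[\sup_{h\in\mathcal H}\sum_{k=1}^N\gamma_k h^\top\tilde u_k\big]$, where $\gamma_1,\dots,\gamma_N$ are i.i.d. taking values $+1,-1,0$ with probabilities $p,p,1-2p$. *)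

(* Defs.v *)
From HB Require Import structures.
From mathcomp Require Import all_boot all_order all_algebra all_fingroup.
From mathcomp Require Import all_classical all_reals exp.
Set Implicit Arguments. Unset Strict Implicit. Unset Printing Implicit Defensive.
Import Order.TTheory GRing.Theory Num.Theory.
Local Open Scope ring_scope.

Definition Npairs (n : nat) : nat := 'C(n, 2).

(* An enumeration k |-> (i_k, j_k) of P_n = {(i,j) : i < j}: an injective map
   from 'I_N into pairs with i < j (hence a bijection onto P_n). *)
Definition pair_enum (n : nat) (e : 'I_(Npairs n) -> 'I_n * 'I_n) : Prop :=
  injective e /\ forall k, ((e k).1 < (e k).2)%N.

Section Defs.
Variable R : realType.

Definition label (n : nat) (s : 'S_n) (e : 'I_(Npairs n) -> 'I_n * 'I_n)
    (k : 'I_(Npairs n)) : R :=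
  Num.sg ((val (s (e k).1))%:R - (val (s (e k).2))%:R).

Definition pscore (d N : nat) (U : 'M[R]_(d, N)) (w : 'cV[R]_d) (k : 'I_N) : R :=
  (w^T *m col k U) 0 0.

Definition prefrank_obj (d N : nat) (U : 'M[R]_(d, N)) (y : 'I_N -> R) (C : R)
    (S : {set 'I_N}) (w : 'cV[R]_d) : R :=
  2^-1 * (\sum_(i < d) w i 0 ^+ 2)
  + C * \sum_(k in S) Num.max 0 (1 - y k * pscore U w k).

Definition prefrank_minimizer (d N : nat) (U : 'M[R]_(d, N)) (y : 'I_N -> R)
    (C : R) (S : {set 'I_N}) (w : 'cV[R]_d) : Prop :=
  forall w' : 'cV[R]_d, prefrank_obj U y C S w <= prefrank_obj U y C S w'.

Definition pair_scores (d N : nat) (U : 'M[R]_(d, N)) (w : 'cV[R]_d) : 'I_N -> R :=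
  fun k => (U^T *m w) k 0.

(* empirical error (1/|T|) sum_{k in T} l(y_k, g_k)  (equals 0 if T is empty) *)
Definition er (N : nat) (l : R -> R -> R) (y : 'I_N -> R) (g : 'I_N -> R)
    (T : {set 'I_N}) : R :=
  (#|T|%:R)^-1 * \sum_(k in T) l (y k) (g k).

Definition HU (d N : nat) (U : 'M[R]_(d, N)) (C : R) (h : 'cV[R]_d) : Prop :=
  exists beta : 'cV[R]_N, h = U *m beta /\ forall k, `|beta k 0| <= C.

Definition rad_val (t : 'I_3) : R :=
  if val t == 0%N then 1 else if val t == 1%N then -1 else 0.
Definition rad_prob (p : R) (t : 'I_3) : R :=
  if val t == 2%N then 1 - 2 * p else p.

Definition trans_rademacher (d N : nat) (H : 'cV[R]_d -> Prop) (U : 'M[R]_(d, N))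
    (p : R) : R :=
  (N%:R)^-1 *
  \sum_(g : {ffun 'I_N -> 'I_3})
     (\prod_(k < N) rad_prob p (g k)) *
     sup (fun x : R => exists h, H h /\ x = \sum_(k < N) rad_val (g k) * pscore U h k).

End Defs.

(* Main.v *)
(** The dual of the SVM problem shows that [wstar S] lies in
    [{U b | y_k b_k in [0, C]}], a translate of one half of [HU U C].  Let [Phi a] be the
    maximum over the finitely many outputs of the linear form [a] in their loss vectors, and
    let [A_S] be [-1/m] on [S] and [1/u] off [S], so that the generalization gap is at most
    [Phi A_S].  Contraction and the half cube give [E Phi(gamma) <= N * R(HU) / (2 * rho)],
    and Jensen's inequality gives [E Phi(gamma) >= (p * N / 2) * E_S (Phi A_S)]: first
    [gamma] is coupled with a Bernoulli(m/N) subset [J], then [J] with a nested uniform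
    [m]-subset [S], the loss [E (#|J| - m)^+] being at most half the variance of [#|J|].
    The two factors [1/2] cancel, so the expected gap satisfies the bound with no additive
    term, which is what makes the claim true for [delta] close to [1]; an Azuma-type
    inequality for sampling without replacement supplies the deviation term. *)

Require Import Defs.
From HB Require Import structures.
From mathcomp Require Import all_boot all_order all_algebra all_fingroup.
From mathcomp Require Import all_classical all_reals exp.
From mathcomp Require Import topology normedtype derive sequences.
From mathcomp Require Import fintype finset.
From mathcomp Require Import ring lra zify.

Set Implicit Arguments.
Unset Strict Implicit.
Unset Printing Implicit Defensive.
Import Order.TTheory GRing.Theory Num.Theory.
Local Open Scope ring_scope.

(** An elementary substitute for Hoeffding's lemma: averaged over a centred variable, the linear
    term disappears and a pure exponential remains. For [x <= 1/2] it follows from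
    [expR (- x) >= 1 - x]; for larger [x], already [x <= 2 * x ^+ 2]. *)
Lemma expR_le_quad (R : realType) (x : R) : expR x <= x + expR (2 * x ^+ 2).
Proof.
have ge1 := expR_ge1Dx (2 * x ^+ 2).
have [xle|xgt] := lerP x (2^-1); last first.
  have : expR x <= expR (2 * x ^+ 2) by rewrite ler_expR; nra.
  by lra.
have x1 : 0 < 1 - x by lra.
have h : expR x <= (1 - x)^-1.
  rewrite -[expR x]invrK lef_pV2 ?posrE ?invr_gt0 ?expR_gt0 //.
  by rewrite -expRN; exact: expR_ge1Dx.
have h2 : (1 - x)^-1 <= 1 + x + 2 * x ^+ 2.
  rewrite -[leLHS]mul1r ler_pdivrMr //.
  have := sqr_ge0 x; rewrite expr2 => s; nra.
lra.
Qed.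

(** * Finite maxima and support functions *)

Section FiniteMax.
Variables (R : realFieldType) (T : finType) (t0 : T).

Definition fmax (F : T -> R) : R := F [arg max_(t > t0) F t]%O.

Lemma fmax_ge F t : F t <= fmax F.
Proof. by rewrite /fmax; case: Order.TotalTheory.arg_maxP => // i _; apply. Qed.

Lemma fmax_ex F : exists t, fmax F = F t.
Proof. by rewrite /fmax; eexists. Qed.

Lemma fmax_le F M : (forall t, F t <= M) -> fmax F <= M.
Proof. by move=> h; exact: h. Qed.

Lemma eq_fmax F G : F =1 G -> fmax F = fmax G.
Proof. by move=> /funext ->. Qed.

Lemma fmaxZ c F : 0 <= c -> fmax (fun t => c * F t) = c * fmax F.
Proof.
move=> c0; apply/eqP; rewrite eq_le; apply/andP; split.
  by apply: fmax_le => t; rewrite ler_wpM2l // fmax_ge.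
by have [t ->] := fmax_ex F; exact: (fmax_ge (fun t => c * F t)).
Qed.

End FiniteMax.

Section SupportFunction.
Variables (R : realFieldType) (I T : finType) (t0 : T) (L : T -> I -> R).

(** The [Phi] of the overview: the support function of the finite set of vectors [L t]. It is
    sublinear, which is the form of convexity used throughout. *)
Definition supp (a : I -> R) : R := fmax t0 (fun t => \sum_k a k * L t k).

Lemma eq_supp a b : a =1 b -> supp a = supp b.
Proof. by move=> /funext ->. Qed.

Lemma supp_ge a t : \sum_k a k * L t k <= supp a.
Proof. exact: (fmax_ge _ (fun t => \sum_k a k * L t k)). Qed.

Lemma suppZ c a : 0 <= c -> supp (fun k => c * a k) = c * supp a.
Proof.
move=> c0; rewrite /supp -fmaxZ //; apply: eq_fmax => t.
by rewrite mulr_sumr; apply: eq_bigr => k _; rewrite mulrA.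
Qed.

Lemma supp_sum (J : finType) (P : pred J) (w : J -> R) (x : J -> I -> R) :
  (forall j, P j -> 0 <= w j) ->
  supp (fun k => \sum_(j | P j) w j * x j k) <= \sum_(j | P j) w j * supp (x j).
Proof.
move=> w0; apply: fmax_le => t.
under eq_bigr do rewrite mulr_suml.
rewrite exchange_big /=; apply: ler_sum => j Pj.
under eq_bigr do rewrite -mulrA.
by rewrite -mulr_sumr ler_wpM2l ?w0 ?supp_ge.
Qed.

End SupportFunction.

(** * Sampling without replacement *)

Section RandomExtension.
Variables (R : realFieldType) (I : finType).
Implicit Types (A S : {set I}) (F G : {set I} -> R).

(* The mean of [F] at [A] enlarged by [r] points drawn without replacement; it is [0] when
   [A] has fewer than [r] points outside it. *)
Fixpoint avg_ext F r A : R :=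
  if r is r'.+1
  then (#|~: A|%:R)^-1 * \sum_(x in ~: A) avg_ext F r' (x |: A)
  else F A.

Lemma card_extend A x : x \in ~: A -> #|x |: A| = #|A|.+1.
Proof. by rewrite inE => xA; rewrite cardsU1 xA. Qed.

Lemma le_avg_ext F G r A :
  (forall S, A \subset S -> #|S| = (#|A| + r)%N -> F S <= G S) ->
  avg_ext F r A <= avg_ext G r A.
Proof.
elim: r A => [|r IH] A FG /=; first by rewrite FG ?addn0.
rewrite ler_wpM2l ?invr_ge0 //; apply: ler_sum => x xA.
apply: IH => S sub; rewrite card_extend // addSnnS => SE; apply: FG => //.
exact: fintype.subset_trans (finset.subsetUr _ _) sub.
Qed.

Lemma eq_avg_ext F G r A :
  (forall S, A \subset S -> #|S| = (#|A| + r)%N -> F S = G S) ->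
  avg_ext F r A = avg_ext G r A.
Proof.
by move=> FG; apply/eqP; rewrite eq_le !le_avg_ext // => S *; rewrite FG.
Qed.

(** Draws may be stopped after [a] points and resumed; this couples a sample of size [a + b] with a
    nested one of size [a]. *)
Lemma avg_extD F a b A : avg_ext F (a + b) A = avg_ext (avg_ext F b) a A.
Proof. by elim: a A => //= a IH A; congr (_ * _); apply: eq_bigr. Qed.

Lemma avg_extZ c F r A : avg_ext (fun S => c * F S) r A = c * avg_ext F r A.
Proof.
elim: r A => //= r IH A; under eq_bigr do rewrite IH.
by rewrite -mulr_sumr mulrCA.
Qed.

Lemma avg_ext_sumr (J : finType) (G : J -> {set I} -> R) r A :
  avg_ext (fun S => \sum_j G j S) r A = \sum_j avg_ext (G j) r A.
Proof.
elim: r A => //= r IH A; under eq_bigr do rewrite IH.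
by rewrite exchange_big mulr_sumr.
Qed.

Lemma card_setC_gt0 A r : (#|A| + r.+1 <= #|I|)%N -> (0 < #|~: A|)%N.
Proof. by have := cardsC A; lia. Qed.

Lemma avg_ext_cst c r A : (#|A| + r <= #|I|)%N -> avg_ext (fun=> c) r A = c.
Proof.
elim: r A => //= r IH A h.
have u0 := card_setC_gt0 h.
under eq_bigr => x xA do rewrite IH ?card_extend ?addSnnS //.
by rewrite sumr_const -[X in _ * X]mulr_natl mulrA mulVf ?mul1r // pnatr_eq0 -lt0n.
Qed.

Lemma avg_ext_mem (i : I) r A : (#|A| + r <= #|I|)%N ->
  avg_ext (fun S => (i \in S)%:R) r A
  = if i \in A then 1 else r%:R / #|~: A|%:R.
Proof.
elim: r A => [|r IH] A h /=; first by case: ifP => //; rewrite mul0r.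
have u0 := card_setC_gt0 h.
have un0 : #|~: A|%:R != 0 :> R by rewrite pnatr_eq0 -lt0n.
under eq_bigr => x xA do rewrite IH ?card_extend ?addSnnS //.
case: ifPn => iA.
  under eq_bigr => x xA do rewrite inE iA orbT.
  by rewrite sumr_const -[X in _ * X]mulr_natl mulrA mulVf // mulr1.
rewrite (bigD1 i) ?inE //= eqxx /=.
rewrite (eq_bigr (fun=> r%:R / (#|~: A|.-1)%:R)) => [|x /andP[xA xi]]; last first.
  rewrite !inE (negPf iA) orbF eq_sym (negPf xi).
  congr (_ / _%:R); have := cardsC A; have := cardsC (x |: A).
  by rewrite card_extend //; lia.
rewrite sumr_const -[X in _ *+ X]/(#|_|).
have -> : #|[pred x in ~: A | x != i]| = #|~: A|.-1.
  by rewrite (cardsD1 i (~: A)) !inE iA /=; apply: eq_card => x; rewrite !inE andbC.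
rewrite mulrC; congr (_ / _).
(* With a single point outside [A] the inner fraction has denominator 0, but then [r = 0]. *)
have [u1|u1] := eqVneq (#|~: A|) 1%N.
  have -> : r = 0%N by have := cardsC A; lia.
  by rewrite u1 mul0r mul0rn addr0.
rewrite -[X in 1 + X]mulr_natr divfK ?pnatr_eq0; last by lia.
by rewrite -natr1 addrC.
Qed.

(** Sequential drawing yields the uniform law on supersets of given size. By double counting, each
    [S] is reached through any of its [r.+1] points outside [A] as the first draw. *)
Lemma avg_ext_sum F r A : (#|A| + r <= #|I|)%N ->
  avg_ext F r A * 'C(#|~: A|, r)%:R
  = \sum_(S : {set I} | (A \subset S) && (#|S| == #|A| + r)%N) F S.
Proof.
elim: r A => [|r IH] A h.
  rewrite bin0 mulr1 (big_pred1 A) // => S; rewrite addn0.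
  apply/idP/eqP => [/andP[sub /eqP SA]|->]; last by rewrite subxx eqxx.
  by apply/eqP; rewrite eq_sym eqEcard sub SA leqnn.
have u0 := card_setC_gt0 h.
have un0 : #|~: A|%:R != 0 :> R by rewrite pnatr_eq0 -lt0n.
have r0 : r.+1%:R != 0 :> R by rewrite pnatr_eq0.
have binE : 'C(#|~: A|, r.+1)%:R = #|~: A|%:R * 'C(#|~: A|.-1, r)%:R / r.+1%:R :> R.
  by apply: (mulIf r0); rewrite divfK // -!natrM mul_bin_diag mulnC.
rewrite binE /=.
set b := 'C(_, r)%:R; set t := \sum_(x in _) _.
have -> : #|~: A|%:R^-1 * t * (#|~: A|%:R * b / r.+1%:R) = t * b / r.+1%:R.
  by rewrite -[_ * b / _]mulrA mulrACA mulVf // mul1r mulrA.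
rewrite {}/t {}/b mulr_suml.
have cE x : x \in ~: A -> #|~: A|.-1 = #|~: (x |: A)|.
  by move=> xA; have := cardsC A; have := cardsC (x |: A); rewrite card_extend //; lia.
under [X in X / _]eq_bigr => x xA do rewrite (cE _ xA) IH ?card_extend // ?addSnnS //.
rewrite (exchange_big_dep
    (fun S : {set I} => (A \subset S) && (#|S| == #|A| + r.+1)%N)) /=; last first.
  move=> x S xA /andP[sub ->]; rewrite andbT.
  exact: fintype.subset_trans (subsetUr _ _) sub.
rewrite mulr_suml; apply: eq_bigr => S /andP[sub /eqP SE].
rewrite (eq_bigl (mem (S :\: A))) => [|x]; last first.
  rewrite !inE subUset sub1set sub SE eqxx !andbT andbC.
  by case: (x \in S).
rewrite sumr_const cardsD (setIidPr sub) SE addKn.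
by rewrite -[X in X / _]mulr_natr mulfK.
Qed.

End RandomExtension.

(** * Concentration for sampling without replacement *)

Section Concentration.
Variables (R : realType) (I : finType) (F : {set I} -> R) (c : R) (m : nat).
Implicit Types (A S : {set I}).
Hypothesis c0 : 0 < c.
Hypothesis F_lip : forall A x y, #|A|.+1 = m -> x \notin A -> y \notin A ->
  F (x |: A) - F (y |: A) <= c.

(** Both continuations use the same next draw [v], which the induction handles, except that drawing
    [y] after [x] is matched with drawing [x] after [y]: these give the same set and cancel. *)
Lemma avg_ext_lip r A x y : (#|A| + r).+1 = m -> (m <= #|I|)%N ->
  x \notin A -> y \notin A ->
  avg_ext F r (x |: A) - avg_ext F r (y |: A) <= c.
Proof.
elim: r A => [|r IH] A Am mI xA yA /=; first by apply: F_lip => //; lia.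
have [->|xy] := eqVneq x y; first by rewrite subrr ltW.
have cE z : z \notin A -> #|~: (z |: A)| = (#|~: A|).-1.
  move=> zA; have := cardsC A; have := cardsC (z |: A).
  by rewrite card_extend ?inE //; lia.
rewrite !cE // -mulrBr.
have u0 : (0 < (#|~: A|).-1)%N by have := cardsC A; lia.
rewrite mulrC ler_pdivrMr ?ltr0n //.
have sE z w : z \notin A -> w \notin A -> w != z ->
    \sum_(v in ~: (z |: A)) avg_ext F r (v |: (z |: A))
    = avg_ext F r (w |: (z |: A))
      + \sum_(v in ~: ([set z; w] :|: A)) avg_ext F r (z |: (v |: A)).
  move=> zA wA wz; rewrite (bigD1 w) ?inE ?negb_or ?wz ?wA //=; congr (_ + _).
  apply: eq_big => [v|v _]; first by rewrite !inE !negb_or andbAC.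
  by rewrite setUCA.
rewrite (sE x y) // 1?eq_sym // (sE y x) //.
rewrite [[set y; x]]setUC [y |: (x |: A)]setUCA opprD addrACA subrr add0r -sumrB.
have -> : (#|~: A|).-1%:R = \sum_(v in ~: ([set x; y] :|: A)) 1 + 1 :> R.
  rewrite sumr_const natr1; congr _%:R.
  have := cardsC A; have := cardsC ([set x; y] :|: A).
  have -> : #|[set x; y] :|: A| = #|A|.+2.
    by rewrite -setUA !cardsU1 !inE negb_or xy xA yA.
  by lia.
have S0 : \sum_(v in ~: ([set x; y] :|: A))
    (avg_ext F r (x |: (v |: A)) - avg_ext F r (y |: (v |: A)))
    <= c * \sum_(v in ~: ([set x; y] :|: A)) 1.
  rewrite mulr_sumr; apply: ler_sum => v; rewrite !inE !negb_or => /andP[/andP[vx vy] vA].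
  rewrite mulr1; apply: IH => //.
  - by rewrite card_extend ?inE //; lia.
  - by rewrite !inE negb_or eq_sym vx.
  - by rewrite !inE negb_or eq_sym vy.
by rewrite mulrDr mulr1 ler_wpDr // ltW.
Qed.

(* The martingale argument behind Azuma's inequality, revealing the sample one point at a time. *)
Lemma avg_ext_mgf (s : R) r A : (#|A| + r)%N = m -> (m <= #|I|)%N ->
  avg_ext (fun S => expR (s * F S)) r A
  <= expR (s * avg_ext F r A + 2 * s ^+ 2 * c ^+ 2 * r%:R).
Proof.
elim: r A => [|r IH] A Am mI /=; first by rewrite mulr0 addr0.
have u0 : (0 < #|~: A|)%N by have := cardsC A; lia.
set u := #|~: A| in u0 *.
have uR : 0 < u%:R :> R by rewrite ltr0n.
set mu := _^-1 * \sum_(x in ~: A) avg_ext F r (x |: A).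
set K := 2 * s ^+ 2 * c ^+ 2.
pose d x := avg_ext F r (x |: A) - mu.
have sumd : \sum_(x in ~: A) d x = 0.
  rewrite sumrB sumr_const -[X in _ - X]mulr_natl /mu mulrA divff ?gt_eqF //.
  by rewrite mul1r subrr.
(* A martingale increment is an average of differences between two choices of the next point, each
   at most [c] in absolute value. *)
have dle x : x \notin A -> d x ^+ 2 <= c ^+ 2.
  move=> xA.
  have avgd : d x = u%:R^-1 * \sum_(z in ~: A)
       (avg_ext F r (x |: A) - avg_ext F r (z |: A)).
    rewrite sumrB sumr_const -[X in X - _]mulr_natl mulrBr mulrA mulVf ?gt_eqF //.
    by rewrite mul1r.
  have cst : c = u%:R^-1 * \sum_(z in ~: A) c.
    by rewrite sumr_const -[X in _ * X]mulr_natl mulrA mulVf ?gt_eqF // mul1r.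
  rewrite -[d x ^+ 2]real_normK ?num_real // ler_pXn2r ?nnegrE ?(ltW c0) //.
  rewrite avgd normrM ger0_norm ?invr_ge0 // [leRHS]cst ler_wpM2l ?invr_ge0 //.
  apply: le_trans (ler_norm_sum _ _ _) _; apply: ler_sum => z; rewrite inE => zA.
  rewrite ler_norml; apply/andP; split; last by apply: avg_ext_lip => //; lia.
  by rewrite lerNl opprB; apply: avg_ext_lip => //; lia.
apply: (@le_trans _ _ (u%:R^-1 * \sum_(x in ~: A)
   (expR (s * mu + K * r%:R) * (s * d x + expR K)))).
  rewrite ler_wpM2l ?invr_ge0 //; apply: ler_sum => x xA.
  apply: le_trans (IH _ _ mI) _; first by rewrite card_extend //; lia.
  have -> : s * avg_ext F r (x |: A) + K * r%:R = (s * mu + K * r%:R) + s * d x.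
    by rewrite /d; ring.
  rewrite expRD ler_wpM2l ?expR_ge0 //.
  apply: le_trans (expR_le_quad _) _; rewrite lerD2l ler_expR /K exprMn.
  rewrite mulrA; apply: ler_wpM2l; first by rewrite mulr_ge0 ?sqr_ge0.
  by apply: dle; rewrite inE in xA.
rewrite -mulr_sumr big_split /= -mulr_sumr sumd mulr0 add0r sumr_const.
rewrite -[X in _ * (_ * X)]mulr_natl [expR _ * (_ * _)]mulrCA mulKf ?gt_eqF // -expRD.
by rewrite -/K ler_expR -[r.+1%:R]natr1 mulrDr mulr1 addrA.
Qed.

Lemma avg_ext_chernoff (b t : R) (bad : pred {set I}) : (m <= #|I|)%N -> (0 < m)%N ->
  0 <= t -> b = avg_ext F m set0 -> (forall S, bad S -> b + t <= F S) ->
  avg_ext (fun S => (bad S)%:R) m set0 <= expR (- (t ^+ 2 / (8 * m%:R * c ^+ 2))).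
Proof.
move=> mI m0 t0 bE badP.
have mR : 0 < m%:R :> R by rewrite ltr0n.
have cc : 0 < c ^+ 2 by rewrite exprn_gt0.
(* The minimizer of [2 * s ^+ 2 * c ^+ 2 * m - s * t]. *)
pose s := t / (4 * m%:R * c ^+ 2).
have s0 : 0 <= s by rewrite divr_ge0 // !mulr_ge0 // ltW.
have := @avg_ext_mgf s m set0; rewrite cards0 add0n => /(_ erefl mI) mgf.
have le1 : avg_ext (fun S => (bad S)%:R) m set0
    <= expR (- (s * (b + t))) * avg_ext (fun S => expR (s * F S)) m set0.
  rewrite -avg_extZ; apply: le_avg_ext => S _ _; rewrite -expRD.
  have [/badP h|_] := boolP (bad S); last exact: expR_ge0.
  apply: le_trans (expR_ge1Dx _); rewrite lerDl -mulrN -mulrDr mulr_ge0 //.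
  by rewrite addrC subr_ge0.
apply: le_trans le1 _; apply: le_trans (ler_wpM2l (expR_ge0 _) mgf) _.
rewrite -bE -expRD ler_expR le_eqVlt; apply/orP; left; apply/eqP.
by rewrite /s; field; rewrite !gt_eqF.
Qed.

End Concentration.

(** * Moments of the binomial law *)

Section Binomial.
Variables (R : realFieldType) (q : R).

Definition binE n (h : nat -> R) : R :=
  \sum_(j < n.+1) 'C(n, j)%:R * q ^+ j * (1 - q) ^+ (n - j) * h j.

Lemma binE1 n : binE n (fun=> 1) = 1.
Proof.
transitivity (((1 - q) + q) ^+ n); last by rewrite subrK expr1n.
rewrite exprDn; apply: eq_bigr => j _.
by rewrite mulr1 -[RHS]mulr_natl -mulrA [q ^+ j * _]mulrC.
Qed.

(** Absorption identity for binomial coefficients: used once it gives the mean, used twice the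
    second moment. *)
Lemma binEM n h : binE n.+1 (fun j => j%:R * h j)
  = n.+1%:R * q * binE n (fun j => h j.+1).
Proof.
rewrite /binE big_ord_recl /= mul0r mulr0 add0r mulr_sumr; apply: eq_bigr => j _.
rewrite /bump /= add1n subSS exprS.
have e : 'C(n.+1, j.+1)%:R * j.+1%:R = n.+1%:R * 'C(n, j)%:R :> R.
  by rewrite -!natrM mulnC -mul_bin_diag.
move: e (q ^+ j) ((1 - q) ^+ (n - j)) (h j.+1).
move: 'C(n.+1, j.+1)%:R j.+1%:R n.+1%:R 'C(n, j)%:R => c1 k1 k2 c2 e x y z.
by transitivity ((c1 * k1) * (q * x * y * z)); [ring | rewrite e; ring].
Qed.

Lemma binED n g h : binE n (fun j => g j + h j) = binE n g + binE n h.
Proof. by rewrite -big_split; apply: eq_bigr => j _; rewrite mulrDr. Qed.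

Lemma binEZ n c h : binE n (fun j => c * h j) = c * binE n h.
Proof. by rewrite mulr_sumr; apply: eq_bigr => j _; rewrite mulrCA. Qed.

Lemma le_binE n g h : 0 <= q <= 1 -> (forall j, g j <= h j) ->
  binE n g <= binE n h.
Proof.
move=> /andP[q0 q1] gh; apply: ler_sum => j _; apply: ler_wpM2l (gh j).
by rewrite !mulr_ge0 ?exprn_ge0 ?subr_ge0.
Qed.

Lemma binE_mean n : binE n (fun j => j%:R) = n%:R * q.
Proof.
case: n => [|n]; first by rewrite /binE big_ord1 mulr0 mul0r.
transitivity (binE n.+1 (fun j => j%:R * 1)).
  by apply: eq_bigr => j _; rewrite mulr1.
by rewrite binEM binE1 mulr1.
Qed.

Lemma binE_sqr n : binE n (fun j => j%:R ^+ 2) = n%:R * q * (1 - q) + (n%:R * q) ^+ 2.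
Proof.
case: n => [|n]; first by rewrite /binE big_ord1 /= mul0r; ring.
transitivity (binE n.+1 (fun j => j%:R * j%:R)).
  by apply: eq_bigr => j _; rewrite expr2.
rewrite binEM.
transitivity (n.+1%:R * q * binE n (fun j => 1 + j%:R)).
  by congr (_ * _); apply: eq_bigr => j _; rewrite -nat1r.
by rewrite binED binE1 binE_mean -natr1; ring.
Qed.

(* On integers [2 * max(x, 0) <= x ^ 2 + x], so the positive part is bounded by half
   the variance. *)
Lemma binE_excess n m : 0 <= q <= 1 -> n%:R * q = m%:R ->
  binE n (fun j => (j - m)%N%:R) <= m%:R * (1 - q) / 2.
Proof.
move=> q01 nq.
apply: (@le_trans _ _ (binE n (fun j => 2^-1 * (j%:R ^+ 2 + (1 - 2 * m%:R) * j%:R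
   + (m%:R ^+ 2 - m%:R) * 1)))).
  apply: le_binE => // j; have [jm|mj] := leqP j m.
    have -> : (j - m = 0)%N by lia.
    have -> : (j%:R ^+ 2 + (1 - 2 * m%:R) * j%:R + (m%:R ^+ 2 - m%:R) * 1)
       = (m - j)%:R * ((m - j)%:R - 1) :> R by rewrite natrB //; ring.
    have : 0 <= (m - j)%:R * ((m - j)%:R - 1) :> R.
      case: (m - j)%N => [|k]; first by rewrite mul0r.
      by rewrite -natr1 addrK mulr_ge0 // addr_ge0.
    lra.
  have -> : (j%:R ^+ 2 + (1 - 2 * m%:R) * j%:R + (m%:R ^+ 2 - m%:R) * 1)
       = (j - m)%:R * ((j - m)%:R + 1) :> R by rewrite natrB 1?ltnW //; ring.
  have : (1 : R) <= (j - m)%:R by rewrite ler1n subn_gt0.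
  by move: (j - m)%:R => k k1; nra.
rewrite binEZ !binED !binEZ binE1 binE_mean binE_sqr nq.
by rewrite le_eqVlt; apply/orP; left; apply/eqP; field.
Qed.

End Binomial.

(** * Bernoulli subsets compared with subsets of fixed size *)

Section BernoulliVsFixedSize.
Variables (R : realFieldType) (I T : finType) (t0 : T) (L : T -> I -> R).
Local Notation Phi := (supp t0 L).
Implicit Types (A S J : {set I}).

Lemma supp_avg_ext (x : {set I} -> I -> R) r A :
  Phi (fun k => avg_ext (fun S => x S k) r A) <= avg_ext (fun S => Phi (x S)) r A.
Proof.
elim: r A => //= r IH A.
rewrite suppZ ?invr_ge0 //; apply: ler_wpM2l; first by rewrite invr_ge0.
rewrite (@eq_supp _ _ _ _ _ _ (fun k => \sum_(z in ~: A)
   1 * avg_ext (fun S => x S k) r (z |: A))); last first.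
  by move=> k; apply: eq_bigr => z _; rewrite mul1r.
apply: le_trans (supp_sum _ _ _ _) _ => //.
by apply: ler_sum => z _; rewrite mul1r IH.
Qed.

(** Given its size, a Bernoulli subset is uniform; its law is a binomial mixture of fixed-size
    laws. *)
Lemma sum_by_card (w : nat -> R) (F : {set I} -> R) :
  \sum_(J : {set I}) w #|J| * F J
  = \sum_(j < #|I|.+1) 'C(#|I|, j)%:R * w j * avg_ext F j set0.
Proof.
rewrite (partition_big (fun J : {set I} => inord #|J| : 'I_#|I|.+1) predT) //=.
apply: eq_bigr => j _.
have := @avg_ext_sum _ _ F j set0; rewrite cards0 add0n setC0 cardsT -ltnS.
move=> /(_ (ltn_ord j)) e.
rewrite -mulrA mulrC -mulrA e mulr_sumr; apply: eq_big => J.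
  rewrite sub0set /= -(inj_eq val_inj) /= inordK // ltnS.
  exact: max_card.
by rewrite -(inj_eq val_inj) /= inordK ?ltnS ?max_card // => /eqP ->.
Qed.

(** Complementation is a bijection between subsets of sizes [a] and [b]. It turns the deletion of
    points into an enlargement, the only move [avg_ext] makes. *)
Lemma avg_extC (F : {set I} -> R) a b : (a + b)%N = #|I| ->
  avg_ext F a set0 = avg_ext (fun S => F (~: S)) b set0.
Proof.
move=> ab.
have := @avg_ext_sum _ _ F a set0; have := @avg_ext_sum _ _ (fun S => F (~: S)) b set0.
rewrite cards0 !add0n setC0 cardsT => /(_ _)/esym e1 /(_ _)/esym e2.
have C0 : 'C(#|I|, a)%:R != 0 :> R by rewrite pnatr_eq0 -lt0n bin_gt0 -ab leq_addr.
apply: (mulIf C0); rewrite -e2 -?ab ?leq_addr //.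
rewrite -[a in 'C(_, a)](addnK b) ab bin_sub -?ab ?leq_addl // ab -e1 -?ab ?leq_addl //.
rewrite (reindex_inj (inv_inj (@setCK I))) /=; apply: eq_bigl => S.
by rewrite !sub0set /=; have := cardsC S; lia.
Qed.

Variables (m u : nat).
Hypotheses (m0 : (0 < m)%N) (u0 : (0 < u)%N) (mu : (m + u)%N = #|I|).

Definition split_vec (a b : R) S k : R := if k \in S then a else b.

(** [J] of size [j] is coupled with a nested [S] of size [m], and Jensen's inequality is applied
    given [S]. The conditional mean of [q - (k \in J)] takes one value on [S] and one off [S];
    truncated subtraction covers both [S] inside [J] and [J] inside [S]. *)
Lemma supp_binomial_level q j : (j <= #|I|)%N ->
  avg_ext (fun S => Phi (split_vec (q - (j%:R - (j - m)%N%:R) / m%:R)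
                                   (q - (j - m)%N%:R / u%:R) S)) m set0
  <= avg_ext (fun J => Phi (fun k => q - (k \in J)%:R)) j set0.
Proof.
move=> jI; have mR : m%:R != 0 :> R by rewrite pnatr_eq0 -lt0n.
have avg_affine (a b : R) A r k : (#|A| + r <= #|I|)%N ->
    avg_ext (fun S => a + b * (k \in S)%:R) r A
    = a + b * avg_ext (fun S => (k \in S)%:R) r A.
  move=> h; pose G (c : bool) S : R := if c then a else b * (k \in S)%:R.
  transitivity (avg_ext (fun S => \sum_c G c S) r A).
    by apply: eq_avg_ext => S _ _; rewrite big_bool.
  by rewrite avg_ext_sumr big_bool /= avg_ext_cst // avg_extZ.
pose F J := Phi (fun k => q - (k \in J)%:R).
have [mj|jm] := leqP m j.
  have -> : avg_ext F j set0 = avg_ext (avg_ext F (j - m)) m set0.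
    by rewrite -avg_extD subnKC.
  apply: le_avg_ext => S _; rewrite cards0 add0n => Sm.
  apply: le_trans (supp_avg_ext _ _ _); rewrite le_eqVlt; apply/orP; left.
  apply/eqP; apply: eq_supp => k.
  rewrite (@eq_avg_ext _ _ _ (fun J => q + -1 * (k \in J)%:R)) => [|J _ _]; last first.
    by rewrite mulN1r.
  rewrite avg_affine ?avg_ext_mem ?Sm ?subnKC // /split_vec.
  have -> : #|~: S| = u by have := cardsC S; lia.
  by rewrite mulN1r natrB // subKr divff //; case: ifP.
(* Here [J] arises from [S] by deletion, so its complement is grown from that of [S]. *)
have -> : avg_ext F j set0
    = avg_ext (fun S => avg_ext (fun J => F (~: J)) (m - j) (~: S)) m set0.
  rewrite (@avg_extC _ j (#|I| - j)) ?subnKC // (@avg_extC _ m u) //.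
  have -> : (#|I| - j = u + (m - j))%N by lia.
  by rewrite avg_extD; apply: eq_avg_ext => S _ _; rewrite setCK.
apply: le_avg_ext => S _; rewrite cards0 add0n => Sm.
apply: le_trans (supp_avg_ext _ _ _); rewrite le_eqVlt; apply/orP; left.
apply/eqP; apply: eq_supp => k.
rewrite (@eq_avg_ext _ _ _ (fun J => q - 1 + 1 * (k \in J)%:R)) => [|J _ _]; last first.
  by rewrite inE; case: (k \in J) => /=; ring.
have CS : #|~: S| = u by have := cardsC S; lia.
rewrite avg_affine ?avg_ext_mem ?CS ?setCK ?Sm; [|lia|lia].
rewrite /split_vec inE; have -> : (j - m = 0)%N by lia.
by case: (k \in S) => /=; rewrite ?(natrB _ (ltnW jm)); [field | ring].
Qed.

(** The vector [A_S] of the overview: paired with a loss vector it gives the error off [S] minus the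
    error on [S]. *)
Definition signed_sample S : I -> R := split_vec (- (m%:R)^-1) u%:R^-1 S.

(** By Jensen's inequality, since [signed_sample S] has mean zero. The sign allows a factor in front
    of this average to be replaced by a lower bound. *)
Lemma supp_signed_avg_ge0 : 0 <= avg_ext (fun S => Phi (signed_sample S)) m set0.
Proof.
apply: le_trans (supp_avg_ext _ _ _).
rewrite (@eq_supp _ _ _ _ _ _ (fun k => 0 * (k == k)%:R)) => [|k].
  by rewrite suppZ // mul0r.
have mI : (#|@set0 I| + m <= #|I|)%N by rewrite cards0; lia.
pose G (c : bool) S : R := if c then u%:R^-1 else - (u%:R^-1 + m%:R^-1) * (k \in S)%:R.
rewrite (@eq_avg_ext _ _ _ (fun S => \sum_c G c S)) => [|S _ _]; last first.
  by rewrite big_bool /= /signed_sample /split_vec; case: (k \in S) => /=; ring.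
rewrite avg_ext_sumr big_bool /= avg_ext_cst // avg_extZ avg_ext_mem // inE.
rewrite setC0 cardsT -mu natrD; field.
by rewrite -natrD !pnatr_eq0; lia.
Qed.

(** Jensen's inequality is applied once more, over the binomial size [j]. The averaged vector is
    [kappa] times [signed_sample S], where [kappa] is [m * u / #|I|] minus the expected excess; that
    excess is at most half of the first term. *)
Lemma supp_bernoulli_ge (q := m%:R / #|I|%:R) :
  m%:R * u%:R / (2 * #|I|%:R) * avg_ext (fun S => Phi (signed_sample S)) m set0
  <= \sum_(J : {set I}) q ^+ #|J| * (1 - q) ^+ (#|I| - #|J|)
       * Phi (fun k => q - (k \in J)%:R).
Proof.
have mR : 0 < m%:R :> R by rewrite ltr0n.
have uR : 0 < u%:R :> R by rewrite ltr0n.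
have NE : #|I|%:R = m%:R + u%:R :> R by rewrite -mu natrD.
have NR : 0 < #|I|%:R :> R by rewrite NE addr_gt0.
have q01 : 0 <= q <= 1.
  by rewrite /q divr_ge0 ?(ltW mR) ?(ltW NR) //= ler_pdivrMr // mul1r NE lerDl ltW.
have nq : #|I|%:R * q = m%:R by rewrite mulrC /q divfK ?gt_eqF.
rewrite (sum_by_card (fun j => q ^+ j * (1 - q) ^+ (#|I| - j))).
pose b (j : 'I_#|I|.+1) := 'C(#|I|, j)%:R * (q ^+ j * (1 - q) ^+ (#|I| - j)).
have b0 j : 0 <= b j.
  by case/andP: q01 => q0 q1; rewrite !mulr_ge0 ?exprn_ge0 ?subr_ge0.
have bE h : \sum_j b j * h (val j) = binE q #|I| h.
  by apply: eq_bigr => j _; rewrite /b mulrA.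
pose v (j : 'I_#|I|.+1) S := split_vec (q - (j%:R - (j - m)%N%:R) / m%:R)
                                   (q - (j - m)%N%:R / u%:R) S.
apply: (@le_trans _ _ (avg_ext (fun S => \sum_j b j * Phi (v j S)) m set0)); last first.
  rewrite avg_ext_sumr; apply: ler_sum => j _; rewrite avg_extZ.
  by apply: ler_wpM2l => //; apply: supp_binomial_level; rewrite -ltnS.
pose ex := binE q #|I| (fun j => (j - m)%N%:R).
pose kappa := m%:R * u%:R / #|I|%:R - ex.
have exle : ex <= m%:R * u%:R / (2 * #|I|%:R).
  apply: le_trans (binE_excess q01 nq) _; rewrite le_eqVlt; apply/orP; left; apply/eqP.
  by rewrite /q NE; field; rewrite -NE gt_eqF.
have kle : m%:R * u%:R / (2 * #|I|%:R) <= kappa.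
  rewrite /kappa; have -> : m%:R * u%:R / #|I|%:R = m%:R * u%:R / (2 * #|I|%:R) * 2 :> R.
    by field; rewrite gt_eqF.
  by lra.
apply: (@le_trans _ _ (kappa * avg_ext (fun S => Phi (signed_sample S)) m set0)).
  by rewrite ler_wpM2r ?supp_signed_avg_ge0.
have k0 : 0 <= kappa by apply: le_trans kle; rewrite divr_ge0 ?mulr_ge0 // ltW.
rewrite -avg_extZ; apply: le_avg_ext => S _ _; rewrite -suppZ //.
apply: le_trans (supp_sum _ _ _ _) => //.
rewrite le_eqVlt; apply/orP; left; apply/eqP; apply: eq_supp => k.
rewrite /signed_sample /v /split_vec; case: ifP => _.
  rewrite (bE (fun j => q - (j%:R - (j - m)%N%:R) / m%:R)).
  transitivity (binE q #|I| (fun j => q * 1 + ((- m%:R^-1) * j%:R + m%:R^-1 * (j - m)%N%:R))).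
    rewrite !binED !binEZ binE1 binE_mean nq -/ex /kappa.
    by rewrite /q NE; field; rewrite -NE !gt_eqF.
  by apply: eq_bigr => j _; congr (_ * _); ring.
rewrite (bE (fun j => q - (j - m)%N%:R / u%:R)).
transitivity (binE q #|I| (fun j => q * 1 + ((- u%:R^-1) * (j - m)%N%:R))).
  rewrite !binED !binEZ binE1 -/ex /kappa.
  by rewrite /q NE; field; rewrite -NE !gt_eqF.
by apply: eq_bigr => j _; congr (_ * _); ring.
Qed.

End BernoulliVsFixedSize.

(** * Rademacher averages: symmetry, contraction, Bernoulli coupling *)

Section Rademacher.
Variables (R : realType) (N : nat) (p : R).
Implicit Types (g : {ffun 'I_N -> 'I_3}) (G : {ffun 'I_N -> 'I_3} -> R).

Definition Erad G : R := \sum_(g : {ffun 'I_N -> 'I_3}) (\prod_(k < N) rad_prob p (g k)) * G g.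

Definition rad_vec g (k : 'I_N) : R := rad_val R (g k).

Lemma EradD G1 G2 : Erad (fun g => G1 g + G2 g) = Erad G1 + Erad G2.
Proof. by rewrite -big_split; apply: eq_bigr => g _; rewrite mulrDr. Qed.

Lemma EradZ c G : Erad (fun g => c * G g) = c * Erad G.
Proof. by rewrite mulr_sumr; apply: eq_bigr => g _; rewrite mulrCA. Qed.

Lemma le_Erad G1 G2 : 0 <= p <= 2^-1 -> (forall g, G1 g <= G2 g) ->
  Erad G1 <= Erad G2.
Proof.
move=> p01 G12; apply: ler_sum => g _; apply: ler_wpM2l (G12 g).
by apply: prodr_ge0 => k _; rewrite /rad_prob; case: ifP => _; lra.
Qed.

Definition swap3 (t : 'I_3) : 'I_3 := tperm ord0 (lift ord0 ord0) t.

Lemma swap3_val t : rad_val R (swap3 t) = - rad_val R t.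
Proof.
rewrite /swap3; case: tpermP => [->|->|]; rewrite /rad_val //= ?opprK //.
by case: t => [[|[|[|//]]] h] /=; rewrite ?oppr0 // => t0 t1;
  [case: t0|case: t1]; apply: val_inj.
Qed.

Lemma swap3_prob t : rad_prob p (swap3 t) = rad_prob p t.
Proof. by rewrite /swap3; case: tpermP => [->|->|]. Qed.

Definition flip (i : 'I_N) g := [ffun k => if k == i then swap3 (g k) else g k].

Lemma flipK i : involutive (flip i).
Proof.
move=> g; apply/ffunP => k; rewrite !ffunE; case: eqP => // _.
by rewrite /swap3 tpermK.
Qed.

(** The values 1 and -1 are equally likely, so negating one coordinate preserves the product law. *)
Lemma Erad_flip i G : Erad G = Erad (fun g => G (flip i g)).
Proof.
rewrite /Erad (reindex_inj (inv_inj (flipK i))); apply: eq_bigr => g _.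
congr (_ * _); apply: eq_bigr => k _; rewrite ffunE; case: eqP => // _.
exact: swap3_prob.
Qed.

Lemma Erad_linear (z : 'I_N -> R) : Erad (fun g => \sum_k rad_vec g k * z k) = 0.
Proof.
rewrite /Erad; under eq_bigr do rewrite mulr_sumr.
rewrite exchange_big big1 // => i _.
have h : Erad (fun g => rad_vec g i * z i) = - Erad (fun g => rad_vec g i * z i).
  rewrite {1}(Erad_flip i) -mulN1r -EradZ; apply: eq_bigr => g _.
  by rewrite /rad_vec ffunE eqxx swap3_val mulNr mulN1r.
rewrite -/(Erad (fun g => rad_vec g i * z i)); lra.
Qed.

Section Contraction.
Variables (T : finType) (t0 : T).

(** With [s] and [t] maximizers of the two terms on the left, the sign of [v * (M' s - M' t)]
    decides which of them is tested in which maximum on the right. *)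
Lemma fmax_contract (A : T -> R) v (M M' : T -> R) :
  (forall s t, `|M s - M t| <= `|M' s - M' t|) ->
  fmax t0 (fun t => A t + v * M t) + fmax t0 (fun t => A t - v * M t)
  <= fmax t0 (fun t => A t + v * M' t) + fmax t0 (fun t => A t - v * M' t).
Proof.
move=> MM'.
have [s ->] := fmax_ex t0 (fun t => A t + v * M t).
have [t ->] := fmax_ex t0 (fun t => A t - v * M t).
have h : v * (M s - M t) <= `|v * (M' s - M' t)|.
  apply: le_trans (ler_norm _) _; rewrite !normrM; exact: ler_wpM2l.
have s1 := fmax_ge t0 (fun t => A t + v * M' t) s.
have t1 := fmax_ge t0 (fun t => A t - v * M' t) t.
have s2 := fmax_ge t0 (fun t => A t - v * M' t) s.
have t2 := fmax_ge t0 (fun t => A t + v * M' t) t.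
move: h; rewrite /= in s1 s2 t1 t2; case: ler0P => _ h; lra.
Qed.

(** Averaging over the pair [g], [flip i g] reduces the claim to the two-point comparison, the other
    coordinates forming the common part [A]. *)
Lemma Erad_contract1 (i : 'I_N) (M M' : T -> 'I_N -> R) : 0 <= p <= 2^-1 ->
  (forall t k, k != i -> M t k = M' t k) ->
  (forall s t, `|M s i - M t i| <= `|M' s i - M' t i|) ->
  Erad (fun g => supp t0 M (rad_vec g)) <= Erad (fun g => supp t0 M' (rad_vec g)).
Proof.
move=> p01 eqM leM.
suff : Erad (fun g => supp t0 M (rad_vec g) + supp t0 M (rad_vec (flip i g)))
    <= Erad (fun g => supp t0 M' (rad_vec g) + supp t0 M' (rad_vec (flip i g))).
  rewrite !EradD -(Erad_flip i (fun g => supp t0 M (rad_vec g))).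
  by rewrite -(Erad_flip i (fun g => supp t0 M' (rad_vec g))); lra.
apply: le_Erad => // g.
have suppE (K : T -> 'I_N -> R) : (forall t k, k != i -> K t k = M' t k) ->
    supp t0 K (rad_vec g) + supp t0 K (rad_vec (flip i g))
  = fmax t0 (fun t => \sum_(k | k != i) rad_vec g k * M' t k + rad_vec g i * K t i)
  + fmax t0 (fun t => \sum_(k | k != i) rad_vec g k * M' t k - rad_vec g i * K t i).
  move=> eqK; congr (_ + _); apply: eq_fmax => t; rewrite (bigD1 i) //= addrC.
    by congr (_ + _); apply: eq_bigr => k ki; rewrite eqK.
  rewrite /rad_vec ffunE eqxx swap3_val mulNr; congr (_ + _).
  by apply: eq_bigr => k ki; rewrite ffunE (negPf ki) eqK.
rewrite !suppE //; exact: (fmax_contract _ _ leM).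
Qed.

(* Talagrand's contraction principle, replacing one coordinate at a time. *)
Lemma Erad_contract (M M' : T -> 'I_N -> R) : 0 <= p <= 2^-1 ->
  (forall s t k, `|M s k - M t k| <= `|M' s k - M' t k|) ->
  Erad (fun g => supp t0 M (rad_vec g)) <= Erad (fun g => supp t0 M' (rad_vec g)).
Proof.
move=> p01 leM.
pose hyb n t (k : 'I_N) := if (k < n)%N then M' t k else M t k.
have step n : (n <= N)%N -> Erad (fun g => supp t0 M (rad_vec g))
    <= Erad (fun g => supp t0 (hyb n) (rad_vec g)).
  elim: n => [|n IH] nN //.
  apply: le_trans (IH (ltnW nN)) _; apply: (@Erad_contract1 (Ordinal nN)) => //.
    move=> t k kn; rewrite /hyb ltnS [(k <= n)%N]leq_eqVlt.
    by rewrite -(inj_eq val_inj) /= in kn; rewrite (negPf kn).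
  by move=> s t; rewrite /hyb /= ltnn ltnSn.
apply: le_trans (step N (leqnn N)) _; rewrite le_eqVlt; apply/orP; left; apply/eqP.
apply: eq_bigr => g _; congr (_ * _); apply: eq_fmax => t; apply: eq_bigr => k _.
by rewrite /hyb ltn_ord.
Qed.

End Contraction.

Lemma prod_bernoulli (a b : R) (J : {set 'I_N}) :
  \prod_k (if k \in J then a else b) = a ^+ #|J| * b ^+ (N - #|J|).
Proof.
rewrite (bigID (mem J)) /=; congr (_ * _).
  by rewrite -prodr_const; apply: eq_bigr => k ->.
have <- : #|~: J| = (N - #|J|)%N by have := cardsC J; rewrite card_ord; lia.
rewrite -prodr_const; apply: eq_big => k; first by rewrite inE.
by move=> /negPf ->.
Qed.

(* A Rademacher variable is coupled with a Bernoulli(q) one so that [-1] only occurs on a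
   success and [1] only on a failure; its conditional mean is then proportional to
   the centred Bernoulli variable, and Jensen's inequality applies. *)
Lemma Erad_bernoulli_ge (T : finType) (t0 : T) (L : T -> 'I_N -> R) q :
  0 < q < 1 -> 0 <= p -> p <= q -> p <= 1 - q ->
  p / (q * (1 - q)) * \sum_(J : {set 'I_N}) q ^+ #|J| * (1 - q) ^+ (N - #|J|)
     * supp t0 L (fun k => q - (k \in J)%:R)
  <= Erad (fun g => supp t0 L (rad_vec g)).
Proof.
move=> /andP[q0 q1] p0 pq pq1.
pose w (b : bool) := if b then q else 1 - q.
(* Joint weights of the coupling. Index 1 (value -1) meets only a success, index 0 (value 1) only a
   failure; index 2 (value 0) takes the rest [w b - p], nonnegative by the bounds on [p]. *)
pose pi (b : bool) (t : 'I_3) : R :=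
  if val t == 2%N then w b - p else if (val t == 1%N) == b then p else 0.
have pi0 b t : 0 <= pi b t.
  by rewrite /pi /w; case: b; case: ifP => _; try case: ifP => _; lra.
have pi_prob t : \sum_b pi b t = rad_prob p t.
  rewrite big_bool /pi /w /rad_prob; case: (val t == 2%N); first by rewrite /=; ring.
  by case: (val t == 1%N) => /=; ring.
have pi_w b : \sum_t pi b t = w b.
  by rewrite !big_ord_recl big_ord0 /pi /w /=; case: b => /=; ring.
have pi_mean b : \sum_t pi b t * rad_val R t = p / (q * (1 - q)) * (q - b%:R) * w b.
  rewrite !big_ord_recl big_ord0 /pi /w /rad_val /=; case: b => /=; field.
    by rewrite !gt_eqF // subr_gt0.
  by rewrite !gt_eqF // subr_gt0.
pose W (J : {set 'I_N}) g := \prod_k pi (k \in J) (g k).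
have -> : Erad (fun g => supp t0 L (rad_vec g))
    = \sum_(J : {set 'I_N}) \sum_(g : {ffun 'I_N -> 'I_3}) W J g * supp t0 L (rad_vec g).
  rewrite exchange_big; apply: eq_bigr => g _; rewrite -mulr_suml; congr (_ * _).
  under eq_bigr do rewrite -pi_prob.
  rewrite bigA_distr_bigA /= (reindex (fun J : {set 'I_N} => [ffun k => k \in J])) /=.
    by apply: eq_bigr => J _; apply: eq_bigr => k _; rewrite ffunE.
  exists (fun b : {ffun 'I_N -> bool} => [set k | b k]) => [J _|b _].
    by apply/setP => k; rewrite inE ffunE.
  by apply/ffunP => k; rewrite ffunE inE.
rewrite mulr_sumr; apply: ler_sum => J _.
apply: le_trans (supp_sum _ _ _ _); last by move=> g _; apply: prodr_ge0.
rewrite -prod_bernoulli mulrA -suppZ; last first.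
  apply: mulr_ge0; first by rewrite divr_ge0 // mulr_ge0 ?subr_ge0 ?ltW.
  by apply: prodr_ge0 => k _; case: ifP => _; lra.
rewrite le_eqVlt; apply/orP; left; apply/eqP; apply: eq_supp => i.
(* With the value at [i] absorbed into the product as one more factor, the sum over [g] factorizes
   over coordinates. *)
transitivity (\sum_(g : {ffun 'I_N -> 'I_3})
    \prod_k (pi (k \in J) (g k) * (if k == i then rad_val R (g k) else 1))).
  rewrite -(bigA_distr_bigA (fun k t =>
    pi (k \in J) t * (if k == i then rad_val R t else 1))) /=.
  rewrite [RHS](bigD1 i) //= eqxx pi_mean.
  rewrite (bigD1 i) //=; rewrite -/(w (i \in J)).
  rewrite [X in _ = _ * X](eq_bigr (fun k => w (k \in J))) => [|k ki].
    set P := \prod_(k | _) w _; rewrite -[X in _ * (_ * X)]/P.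
    by ring.
  by rewrite -pi_w (negPf ki); apply: eq_bigr => t _; rewrite mulr1.
apply: eq_bigr => g _; rewrite big_split /= /W; congr (_ * _).
by rewrite (bigD1 i) //= eqxx big1 ?mulr1 // => k /negPf ->.
Qed.

End Rademacher.

(** * Scores and SVM duality *)

Lemma pscoreE (R : realType) d N (U : 'M[R]_(d, N)) w k :
  pscore U w k = \sum_i w i 0 * U i k.
Proof. by rewrite /pscore mxE; apply: eq_bigr => i _; rewrite !mxE. Qed.

Lemma pair_scoresE (R : realType) d N (U : 'M[R]_(d, N)) w k :
  pair_scores U w k = pscore U w k.
Proof.
rewrite pscoreE /pair_scores mxE; apply: eq_bigr => i _.
by rewrite !mxE mulrC.
Qed.

Section BoxMinimum.
Import numFieldNormedType.Exports.
Variables (R : realType) (d N : nat).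

(** [D] is the SVM dual objective once the columns of [V] carry the labels; it is continuous on a
    compact box, so its minimum is attained. *)
Lemma box_min_quadratic (V : 'M[R]_(d, N)) (c : 'I_N -> R) : (forall k, 0 <= c k) ->
  let D (a : 'rV[R]_N) :=
    2^-1 * \sum_i (\sum_k a 0 k * V i k) ^+ 2 - \sum_k a 0 k in
  exists2 a : 'rV[R]_N, forall k, 0 <= a 0 k <= c k
    & forall b : 'rV[R]_N, (forall k, 0 <= b 0 k <= c k) -> D a <= D b.
Proof.
move=> c0 D.
pose A : set 'rV[R]_N := [set v | forall k, `[0, c k]%classic (v ord0 k)]%classic.
have AE v : A v <-> forall k, 0 <= v 0 k <= c k.
  by split=> h k; have := h k; rewrite /= in_itv.
have cA : compact A by apply: (@rV_compact R N (fun k => `[0, c k]%classic)) => k;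
  exact: segment_compact.
have A0 : (A !=set0)%classic.
  by exists 0; apply/AE => k; rewrite mxE lexx c0.
have ccoord k : continuous (fun a : 'rV[R]_N => a 0 k) by exact: coord_continuous.
have csum n (h : 'I_n -> 'rV[R]_N -> R) : (forall i, continuous (h i)) ->
    continuous (fun a => \sum_i h i a).
  by move=> ch; apply: continuous_big => //; exact: add_continuous.
have cM (f g : 'rV[R]_N -> R) : continuous f -> continuous g ->
    continuous (fun a => f a * g a).
  by move=> cf cg x; exact: (continuousM (cf x) (cg x)).
have ccst (x : R) : continuous (fun _ : 'rV[R]_N => x) by exact: cst_continuous.
have cD : continuous D.
  have cB (f g : 'rV[R]_N -> R) : continuous f -> continuous g ->
      continuous (fun a => f a - g a).
    by move=> cf cg x; exact: (continuousB (cf x) (cg x)).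
  apply: cB; last by apply: (csum _) => k.
  apply: (cM) => //; apply: (csum _) => i.
  have cl : continuous (fun a : 'rV[R]_N => \sum_k a 0 k * V i k).
    by apply: (csum _) => k; apply: (cM).
  by under eq_fun do rewrite expr2; apply: (cM).
have [a aA amin] := EVT_min_rV A0 cA (continuous_subspaceT cD).
exists a; first by apply/AE; exact: set_mem aA.
by move=> b bA; apply: amin; apply: mem_set; apply/AE.
Qed.

End BoxMinimum.

(** First-order condition from one-sided variations: if [g] were negative, the linear term would
    dominate for [t] up to [- g / (q + 1)], where the added 1 covers [q = 0]. *)
Lemma quad_ge0_right (R : realFieldType) (g q s : R) : 0 <= q -> 0 < s ->
  (forall t, 0 <= t <= s -> 0 <= t * g + 2^-1 * t ^+ 2 * q) -> 0 <= g.
Proof.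
move=> q0 s0 h; rewrite leNgt; apply/negP => g0.
have q1 : 0 < q + 1 by lra.
have r0 : 0 < - g / (q + 1) by rewrite divr_gt0 // oppr_gt0.
pose t := Num.min s (- g / (q + 1)).
have t0 : 0 < t by rewrite lt_min s0.
have ts : t <= s by rewrite ge_min lexx.
have tr : t * (q + 1) <= - g by rewrite -ler_pdivlMr // ge_min lexx orbT.
have := h t; rewrite ts ltW // => /(_ isT).
have -> : t * g + 2^-1 * t ^+ 2 * q = t * (g + 2^-1 * t * q) by ring.
rewrite pmulr_rge0 //; nra.
Qed.

Section Duality.
Variables (R : realType) (d N : nat) (U : 'M[R]_(d, N)) (y : 'I_N -> R) (C : R).
Hypothesis C0 : 0 < C.

(* The dual problem has a solution [a] by compactness; its optimality conditions make
   [U (y a)] a primal solution, and the primal objective is strongly convex. *)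
Lemma prefrank_dual (S : {set 'I_N}) (w : 'cV[R]_d) :
  prefrank_minimizer U y C S w ->
  exists2 a : 'I_N -> R, forall k, 0 <= a k <= C
    & w = U *m (\col_k (y k * a k)).
Proof.
move=> wmin.
pose V : 'M[R]_(d, N) := \matrix_(i, k) (y k * U i k).
(* Outside [S] the box is reduced to 0, which removes those coordinates from the dual. *)
pose c k := if k \in S then C else 0.
have c0 k : 0 <= c k by rewrite /c; case: ifP => // _; exact: ltW.
have [a abox amin] := box_min_quadratic V c0.
pose v i := \sum_k a 0 k * V i k.
have vE : U *m (\col_k (y k * a 0 k)) = \col_i v i.
  apply/matrixP => i j; rewrite !mxE; apply: eq_bigr => k _.
  by rewrite !mxE; ring.
exists (fun k => a 0 k).
  move=> k; have /andP[-> h] := abox k; apply: le_trans h _.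
  by rewrite /c; case: ifP => // _; exact: ltW.
pose mar (x : 'cV[R]_d) k := y k * pscore U x k.
have marE x k : mar x k = \sum_i x i 0 * V i k.
  by rewrite /mar pscoreE mulr_sumr; apply: eq_bigr => i _; rewrite mxE mulrCA.
pose v0 : 'cV[R]_d := \col_i v i.
have v0E i : v0 i 0 = v i by rewrite mxE.
(* [g k] and [q k] are the first and second derivatives of the dual objective in coordinate [k]. *)
pose g k := mar v0 k - 1.
pose q k := \sum_i V i k ^+ 2.
have var k t : 0 <= a 0 k + t <= c k -> 0 <= t * g k + 2^-1 * t ^+ 2 * q k.
  move=> tk; pose b : 'rV[R]_N := \row_j (a 0 j + (j == k)%:R * t).
  have bbox j : 0 <= b 0 j <= c j.
    by rewrite mxE; case: eqP => [->|_]; rewrite ?mul1r // mul0r addr0.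
  have := amin b bbox; rewrite -subr_ge0.
  have sumb (z : 'I_N -> R) : \sum_j b 0 j * z j = \sum_j a 0 j * z j + t * z k.
    under eq_bigr do rewrite mxE mulrDl.
    rewrite big_split /=; congr (_ + _); rewrite (bigD1 k) //= eqxx mul1r.
    by rewrite big1 ?addr0 // => j /negPf ->; rewrite !mul0r.
  have -> : \sum_j b 0 j = \sum_j a 0 j + t.
    rewrite -[t]mulr1 -(eq_bigr _ (fun j _ => mulr1 (a 0 j))) -(sumb (fun=> 1)).
    by apply: eq_bigr => j _; rewrite mulr1.
  have -> : \sum_i (\sum_k0 b 0 k0 * V i k0) ^+ 2
      = \sum_i v i ^+ 2 + (2 * t * mar v0 k + t ^+ 2 * q k).
    rewrite marE !mulr_sumr -!big_split /=; apply: eq_bigr => i _.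
    by rewrite sumb v0E -/(v i); ring.
  rewrite -/(v _) /g => h; apply: le_trans h _; rewrite le_eqVlt; apply/orP; left.
  by apply/eqP; rewrite -/v; field.
have q0 k : 0 <= q k by apply: sumr_ge0 => i _; exact: sqr_ge0.
have kkt_right k : a 0 k < c k -> 0 <= g k.
  rewrite -subr_gt0 => ac; apply: (quad_ge0_right (q0 k) ac) => t /andP[t0 tc].
  by apply: var; have /andP[? ?] := abox k; lra.
have kkt_left k : 0 < a 0 k -> g k <= 0.
  move=> a0; rewrite -oppr_ge0; apply: (quad_ge0_right (q0 k) a0) => t /andP[t0 ta].
  have := var k (- t); rewrite sqrrN mulNr -mulrN; apply.
  by have /andP[? ?] := abox k; lra.
(* By the optimality conditions [- a 0 k] is a subgradient, at [mar v0 k], of [C] times the hinge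
   loss. *)
have hinge x k : k \in S ->
    C * Num.max 0 (1 - mar v0 k) - a 0 k * (mar x k - mar v0 k)
    <= C * Num.max 0 (1 - mar x k).
  move=> kS; have cE : c k = C by rewrite /c kS.
  have h0 z : 0 <= C * Num.max 0 z :> R by rewrite mulr_ge0 ?(ltW C0) // le_max lexx.
  have hz z : C * z <= C * Num.max 0 z :> R by rewrite ler_pM2l // le_max lexx orbT.
  have {}h0 := h0 (1 - mar x k); have {}hz := hz (1 - mar x k).
  have := kkt_left k; have := kkt_right k; rewrite cE /g.
  have /andP[ak0 akC] := abox k; rewrite cE in akC.
  move: (a 0 k) ak0 akC (Num.max 0 (1 - mar x k)) h0 hz => al ak0 akC hx h0 hz kr kl.
  have [alC|alC] := ltrP al C; last first.
    have {}alC : al = C by lra.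
    have := kl; rewrite alC => /(_ C0) m1.
    by rewrite max_r; lra.
  have m1 := kr alC; rewrite max_l; last by lra.
  have [al0|al0] := ltrP 0 al; last first.
    have -> : al = 0 by lra.
    by rewrite mulr0 mul0r subr0.
  have m2 := kl al0; have -> : mar v0 k = 1 by lra.
  by rewrite mulr0 sub0r; have [?|?] := lerP (1 - mar x k) 0; nra.
(* The subgradient terms cancel the linear part of the squared norm; the quadratic growth that
   remains forces every minimizer to equal [v0]. *)
have obj_ge (x : 'cV[R]_d) : prefrank_obj U y C S v0 + 2^-1 * \sum_i (x i 0 - v i) ^+ 2
    <= prefrank_obj U y C S x.
  have inner : \sum_k a 0 k * (mar x k - mar v0 k) = \sum_i v i * (x i 0 - v i).
    under [RHS]eq_bigr do rewrite mulr_suml.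
    rewrite exchange_big /=; apply: eq_bigr => k _.
    rewrite !marE -sumrB mulr_sumr; apply: eq_bigr => i _.
    by rewrite v0E; ring.
  have innerS : \sum_(k in S) a 0 k * (mar x k - mar v0 k)
      = \sum_k a 0 k * (mar x k - mar v0 k).
    rewrite [RHS](bigID (mem S)) /= [X in _ + X]big1 ?addr0 // => k kS.
    have := abox k; rewrite /c (negPf kS) => h.
    have -> : a 0 k = 0 by lra.
    by rewrite mul0r.
  have hingeS : C * \sum_(k in S) Num.max 0 (1 - mar v0 k)
      - \sum_i v i * (x i 0 - v i)
      <= C * \sum_(k in S) Num.max 0 (1 - mar x k).
    rewrite -inner -innerS !mulr_sumr -sumrB; apply: ler_sum => k kS; exact: hinge.
  rewrite /prefrank_obj -/(mar v0 _) -/(mar x _).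
  have -> : \sum_i x i 0 ^+ 2 = \sum_i v0 i 0 ^+ 2
     + (2 * \sum_i v i * (x i 0 - v i) + \sum_i (x i 0 - v i) ^+ 2).
    rewrite mulr_sumr -!big_split /=; by apply: eq_bigr => i _; rewrite v0E; ring.
  move: hingeS; rewrite /mar; lra.
have sq0 : \sum_i (w i 0 - v i) ^+ 2 = 0.
  apply/eqP; rewrite eq_le sumr_ge0 ?andbT => [|i _]; last exact: sqr_ge0.
  have := obj_ge w; have := wmin v0; lra.
rewrite vE; apply/matrixP => i j; rewrite ord1 mxE; apply/eqP.
rewrite -subr_eq0 -sqrf_eq0; apply/eqP.
by apply: (psumr_eq0P _ sq0) => // k _; exact: sqr_ge0.
Qed.

End Duality.

(** * Rademacher complexity of the hypothesis cube *)

Section RademacherBound.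
Variables (R : realType) (d N : nat) (U : 'M[R]_(d, N)) (C : R).
Hypothesis C0 : 0 < C.

Definition rad_set (g : {ffun 'I_N -> 'I_3}) : set R :=
  fun x : R => exists h, HU U C h /\ x = \sum_(k < N) rad_val R (g k) * pscore U h k.

Lemma rad_val_norm t : `|rad_val R t| <= 1.
Proof.
by rewrite /rad_val; case: ifP => _; [|case: ifP => _]; rewrite ?normrN ?normr1 ?normr0.
Qed.

(** Boundedness ensures that [sup] is a true supremum and not its default value. *)
Lemma rad_set_ub g : has_ubound (rad_set g).
Proof.
exists (\sum_k \sum_i \sum_j `|U i j| * C * `|U i k|) => x [h [[b [-> bC]] ->]].
apply: ler_sum => k _; apply: le_trans (ler_norm _) _; rewrite normrM.
apply: (@le_trans _ _ (1 * `|pscore U (U *m b) k|)).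
  by rewrite ler_wpM2r ?rad_val_norm.
rewrite mul1r pscoreE; apply: le_trans (ler_norm_sum _ _ _) _.
apply: ler_sum => i _; rewrite normrM mxE -mulr_suml ler_wpM2r //.
apply: le_trans (ler_norm_sum _ _ _) _; apply: ler_sum => j _.
by rewrite normrM ler_wpM2l.
Qed.

Lemma rad_set_le g (b : 'cV[R]_N) : (forall k, `|b k 0| <= C) ->
  \sum_k rad_vec R g k * pscore U (U *m b) k <= sup (rad_set g).
Proof.
by move=> bC; apply: (ub_le_sup (rad_set_ub g)); exists (U *m b); split=> //; exists b.
Qed.

Lemma trans_rademacher_ge0 p : 0 <= p <= 2^-1 -> 0 <= trans_rademacher (HU U C) U p.
Proof.
move=> p01; rewrite /trans_rademacher mulr_ge0 ?invr_ge0 //.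
apply: sumr_ge0 => g _; apply: mulr_ge0.
  by apply: prodr_ge0 => k _; rewrite /rad_prob; case: ifP => _; lra.
have := @rad_set_le g 0; rewrite mulmx0 big1 => [|k _]; last first.
  by rewrite pscoreE big1 ?mulr0 // => i _; rewrite mxE mul0r.
by apply=> k; rewrite mxE normr0 ltW.
Qed.

(* The solutions lie in a translate of half the cube [HU]; the translation averages out. *)
Lemma Erad_half_cube (T : finType) (t0 : T) (y : 'I_N -> R) (a : T -> 'I_N -> R) p :
  0 <= p <= 2^-1 -> (forall k, `|y k| <= 1) -> (forall t k, 0 <= a t k <= C) ->
  Erad p (fun g => supp t0 (fun t => pscore U (U *m \col_k (y k * a t k))) (rad_vec R g))
  <= 2^-1 * \sum_(g : {ffun 'I_N -> 'I_3})
       (\prod_(k < N) rad_prob p (g k)) * sup (rad_set g).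
Proof.
move=> p01 y1 aC.
pose z := pscore U (U *m \col_k (2^-1 * C * y k)).
rewrite -/(Erad p (fun g => sup (rad_set g))).
rewrite -[leRHS]add0r -(Erad_linear p z) -(EradZ p _ (fun g => sup (rad_set g))) -EradD.
apply: le_Erad => // g; apply: fmax_le => t.
(* From [a = C / 2 + (2 * a - C) / 2]: the first term yields [z], which is independent of [t], and
   the second is half a point of the cube. *)
pose b := \col_k (y k * (2 * a t k - C)) : 'cV[R]_N.
have -> : \sum_k rad_vec R g k * pscore U (U *m \col_k (y k * a t k)) k
   = \sum_k rad_vec R g k * z k + 2^-1 * \sum_k rad_vec R g k * pscore U (U *m b) k.
  rewrite mulr_sumr -big_split /=; apply: eq_bigr => k _.
  rewrite mulrCA -mulrDr; congr (_ * _); rewrite /z !pscoreE mulr_sumr -big_split /=.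
  apply: eq_bigr => i _; rewrite mulrA -mulrDl; congr (_ * _).
  rewrite !mxE mulr_sumr -big_split /=; apply: eq_bigr => j _; rewrite !mxE.
  by field.
rewrite lerD2l ler_wpM2l ?invr_ge0 //=; apply: rad_set_le => k.
rewrite mxE normrM -[leRHS]mul1r; apply: ler_pM => //.
by rewrite ler_norml; have /andP[? ?] := aC t k; lra.
Qed.

End RademacherBound.

(** * The generalization gap and its expectation *)

Section Gap.
Variables (R : realType) (N m u : nat).
Hypothesis mu : (m + u)%N = N.
Implicit Types (A S : {set 'I_N}).

Lemma er_gap (l : R -> R -> R) (y g : 'I_N -> R) S : #|S| = m ->
  er l y g (~: S) - er l y g S
  = \sum_k signed_sample R m u S k * l (y k) (g k).
Proof.
move=> Sm; have CS : #|~: S| = u by have := cardsC S; rewrite card_ord; lia.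
rewrite /er CS Sm [RHS](bigID (mem S)) /= addrC -mulNr !mulr_sumr; congr (_ + _).
  apply: eq_big => k; first by rewrite inE.
  by rewrite inE /signed_sample /split_vec => /negPf ->.
by apply: eq_bigr => k kS; rewrite /signed_sample /split_vec kS.
Qed.

(** Exchanging one point changes two coordinates of [signed_sample] by opposite amounts
    [m^-1 + u^-1]. Losses lie in [[0, B]], so the difference of the two losses contributes [B] and
    not [2 * B]. *)
Lemma gap_lipschitz (T : finType) (t0 : T) (L : T -> 'I_N -> R) B A i j :
  (forall t k, 0 <= L t k <= B) -> i \notin A -> j \notin A ->
  supp t0 L (signed_sample R m u (i |: A)) - supp t0 L (signed_sample R m u (j |: A))
  <= B * (m%:R^-1 + u%:R^-1).
Proof.
move=> LB iA jA.
have [t tE] := fmax_ex t0 (fun t => \sum_k signed_sample R m u (i |: A) k * L t k).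
rewrite {1}/supp tE lerBlDr -lerBlDl.
apply: le_trans (supp_ge t0 L _ t).
rewrite lerBlDl -lerBlDr -sumrB.
rewrite (eq_bigr (fun k => (m%:R^-1 + u%:R^-1) * ((k == j)%:R * L t k - (k == i)%:R * L t k))).
  rewrite -mulr_sumr sumrB.
  have one x : \sum_k (k == x)%:R * L t k = L t x.
    rewrite (bigD1 x) //= eqxx mul1r big1 ?addr0 // => k /negPf ->.
    by rewrite mul0r.
  rewrite !one mulrC ler_wpM2r ?addr_ge0 ?invr_ge0 //.
  by have /andP[? ?] := LB t i; have /andP[? ?] := LB t j; lra.
move=> k _; rewrite /signed_sample /split_vec !inE.
have [->|ki] := eqVneq k i; first by rewrite (negPf iA) orbF; case: (i == j) => /=; ring.
have [->|kj] := eqVneq k j; first by rewrite (negPf jA) /=; ring.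
by case: (k \in A) => /=; ring.
Qed.

Hypotheses (m0 : (0 < m)%N) (u0 : (0 < u)%N).

(** Chains the Bernoulli comparison, the coupling with Rademacher signs, contraction by [rho^-1] and
    the half-cube bound. The sampling rate is [q = m / N], which rounding separates from [f]. *)
Lemma expected_gap_le (d : nat) (U : 'M[R]_(d, N)) (C f rho : R) (T : finType)
    (t0 : T) (y : 'I_N -> R) (a : T -> 'I_N -> R) (L : T -> 'I_N -> R) :
  0 < f <= 2^-1 -> 0 < rho ->
  N%:R * f <= m%:R -> (2 * m <= N.+1)%N ->
  (forall k, `|y k| <= 1) -> (forall t k, 0 <= a t k <= C) ->
  (forall s t k, `|L s k - L t k| <=
     rho^-1 * `|pscore U (U *m \col_k (y k * a s k)) k
                - pscore U (U *m \col_k (y k * a t k)) k|) ->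
  avg_ext (fun S => supp t0 L (signed_sample R m u S)) m set0
  <= trans_rademacher (HU U C) U (f * (1 - f)) / (rho * f * (1 - f)).
Proof.
move=> /andP[f0 f2] rho0 Nf m2 y1 aC Lip.
pose p := f * (1 - f); pose q : R := m%:R / N%:R.
have mR : 0 < m%:R :> R by rewrite ltr0n.
have uR : 0 < u%:R :> R by rewrite ltr0n.
have NE : N%:R = m%:R + u%:R :> R by rewrite -mu natrD.
have NR : 0 < N%:R :> R by rewrite NE addr_gt0.
have p0 : 0 < p by rewrite mulr_gt0 //; lra.
have p4 : p <= 4^-1 by rewrite /p; have := sqr_ge0 (f - 2^-1); nra.
have p01 : 0 <= p <= 2^-1 by rewrite ltW //=; lra.
have q1 : 1 - q = u%:R / N%:R by rewrite /q NE; field; rewrite -NE gt_eqF.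
have q01 : 0 < q < 1 by rewrite divr_gt0 //= -subr_gt0 q1 divr_gt0.
have fq : f <= q by rewrite ler_pdivlMr // mulrC.
have pq : p <= q by rewrite /p; nra.
(* Rounding may push [q] above [1/2], but [p <= 1/4], while [2 * m <= N + 1] and [u > 0] give
   [N <= 4 * u]. *)
have pq1 : p <= 1 - q.
  rewrite q1 ler_pdivlMr //.
  have Nu : (N%:R <= 4 * u%:R :> R).
    by rewrite -natrM ler_nat; move: m2 m0 u0 mu; clear; lia.
  apply: (le_trans (ler_wpM2r (ltW NR) p4)); lra.
have := supp_bernoulli_ge t0 L m0 u0; rewrite card_ord => /(_ mu).
rewrite -/q => h1.
have h2 := Erad_bernoulli_ge t0 L q01 (ltW p0) pq pq1.
pose M t k := rho^-1 * pscore U (U *m \col_k (y k * a t k)) k.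
have h3 : Erad p (fun g => supp t0 L (rad_vec R g)) <= Erad p (fun g => supp t0 M (rad_vec R g)).
  apply: Erad_contract => // s t k; rewrite -mulrBr normrM.
  by rewrite [`|rho^-1|]gtr0_norm ?invr_gt0.
have h4 : Erad p (fun g => supp t0 M (rad_vec R g))
   = rho^-1 * Erad p (fun g =>
       supp t0 (fun t => pscore U (U *m \col_k (y k * a t k))) (rad_vec R g)).
  rewrite -EradZ; apply: eq_bigr => g _; congr (_ * _).
  rewrite /supp -fmaxZ ?invr_ge0 1?ltW //; apply: eq_fmax => t.
  by rewrite mulr_sumr; apply: eq_bigr => k _; rewrite /M mulrCA.
have h5 := Erad_half_cube U t0 p01 y1 aC.
set G := avg_ext _ _ _ in h1 *.
pose sumsup := \sum_(g : {ffun 'I_N -> 'I_3})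
       (\prod_(k < N) rad_prob p (g k)) * sup (rad_set U C g).
have -> : trans_rademacher (HU U C) U (f * (1 - f)) / (rho * f * (1 - f))
    = (2 / (p * N%:R)) * (rho^-1 * (2^-1 * sumsup)).
  have -> : trans_rademacher (HU U C) U (f * (1 - f)) = N%:R^-1 * sumsup by [].
  by rewrite /p; field; rewrite !gt_eqF //; lra.
(* As [q * (1 - q) = m * u / N ^+ 2], the two Bernoulli factors multiply to [p * N / 2]. *)
have -> : G = 2 / (p * N%:R) * (p / (q * (1 - q)) * (m%:R * u%:R / (2 * N%:R) * G)).
  by rewrite q1 /q; field; rewrite !gt_eqF.
apply: ler_wpM2l; first by rewrite divr_ge0 // mulr_ge0 // ltW.
apply: (@le_trans _ _ (rho^-1 * Erad p (fun g =>
       supp t0 (fun t => pscore U (U *m \col_k (y k * a t k))) (rad_vec R g)))); last first.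
  by apply: ler_wpM2l => //; rewrite invr_ge0 ltW.
rewrite -h4; apply: le_trans h3; apply: le_trans h2.
case/andP: q01 => q0 q1'; apply: ler_wpM2l => //.
by rewrite divr_ge0 ?(ltW p0) // mulr_ge0 ?subr_ge0 ?ltW.
Qed.

End Gap.

(** * Labels, sample size and the final bound *)

Lemma label_pm1 (R : realType) n (s : 'S_n) e k : pair_enum e ->
  label R s e k = 1 \/ label R s e k = -1.
Proof.
move=> [_ elt]; rewrite /label; case: sgrP => h; [|by left|by right].
have e12 : (e k).1 = (e k).2.
  apply: (@perm_inj _ s); apply: val_inj; apply/eqP.
  by rewrite -(eqr_nat R) -subr_eq0 h.
by have := elt k; rewrite e12 ltnn.
Qed.

(** The ceiling lies strictly below [N / 2 + 1], so the integer [2 * m] is at most [N + 1]. *)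
Lemma ceil_half_bounds (R : realType) (N : nat) (f : R) : 0 < f <= 2^-1 ->
  exists m : nat, [/\ Num.ceil (N%:R * f) = Posz m, N%:R * f <= m%:R,
    (2 * m <= N.+1)%N & (m <= N)%N].
Proof.
move=> /andP[f0 f2].
have c0 : 0 <= Num.ceil (N%:R * f).
  by rewrite ceil_ge0; apply: lt_le_trans (mulr_ge0 _ (ltW f0)); rewrite ?ltrN10.
have [m mE] : exists m : nat, Num.ceil (N%:R * f) = Posz m.
  by exists `|Num.ceil (N%:R * f)|%N; rewrite gez0_abs.
have /andP[lo hi] := ceil_itv (N%:R * f); rewrite mE in lo hi.
have lo' : m%:R - 1 < N%:R * f by move: lo; rewrite intrB.
have Nf : N%:R * f <= N%:R * 2^-1 by rewrite ler_wpM2l.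
exists m; split=> //.
  rewrite -ltnS -(ltr_nat R) natrM -natr1 -natr1; lra.
rewrite -ltnS -(ltr_nat R) -natr1; have : 0 <= N%:R :> R by []; lra.
Qed.

(** A nonempty rest absorbs the rounding error of 1 by doubling; this later bounds [u^-1] by
    [2 / k]. *)
Lemma half_le_twice_rest N k : (2 * k <= N.+1)%N -> (0 < N - k)%N ->
  (k <= 2 * (N - k))%N.
Proof. by lia. Qed.

Theorem theorem1 (R : realType) :
  exists C1 : R, 0 < C1 /\
  forall (n d : nat) (s : 'S_n) (e : 'I_(Npairs n) -> 'I_n * 'I_n),
  pair_enum e ->
  forall (U : 'M[R]_(d, Npairs n)) (C : R), 0 < C ->
  forall f : R, 0 < f <= 2^-1 ->
  forall (l : R -> R -> R) (B rho : R), 0 < rho ->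
  (forall y a, (y = 1 \/ y = -1) -> 0 <= l y a <= B) ->
  (forall y a a', (y = 1 \/ y = -1) -> `|l y a - l y a'| <= rho^-1 * `|a - a'|) ->
  forall wstar : {set 'I_(Npairs n)} -> 'cV[R]_d,
  (forall S, prefrank_minimizer U (label R s e) C S (wstar S)) ->
  forall delta : R, 0 < delta ->
  let N := Npairs n in
  let y := label R s e in
  let p := f * (1 - f) in
  let good (S : {set 'I_N}) : bool :=
    er l y (pair_scores U (wstar S)) (~: S)
      <= er l y (pair_scores U (wstar S)) S
         + trans_rademacher (HU U C) U p / (rho * f * (1 - f))
         + C1 * B * Num.sqrt (ln (delta^-1)) / ((1 - f) * Num.sqrt (N%:R * f)) in
  let m : int := Num.ceil (N%:R * f) in
  1 - delta <=
    #|[set S : {set 'I_N} | (Posz #|S| == m) && good S]|%:R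
    / #|[set S : {set 'I_N} | Posz #|S| == m]|%:R.
Proof.
(* With [c = 3 * B / k] the Chernoff exponent is [dev ^+ 2 * k / (72 * B ^+ 2)]. Since [N * f <= k]
   and [1 - f <= 1], it suffices that the square of the constant be at least 72; 9 is the least such
   integer. *)
exists 9; split=> // n d s e eP U C C0 f f01 l B rho rho0 lB lLip w wmin delta delta0.
pose N := Npairs n; pose y := label R s e; pose p := f * (1 - f).
pose good (S : {set 'I_N}) : bool :=
    er l y (pair_scores U (w S)) (~: S)
      <= er l y (pair_scores U (w S)) S
         + trans_rademacher (HU U C) U p / (rho * f * (1 - f))
         + 9 * B * Num.sqrt (ln (delta^-1)) / ((1 - f) * Num.sqrt (N%:R * f)).
pose m : int := Num.ceil (N%:R * f).
change (1 - delta <=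
    #|[set S : {set 'I_N} | (Posz #|S| == m) && good S]|%:R
    / #|[set S : {set 'I_N} | Posz #|S| == m]|%:R).
have y1 k : y k = 1 \/ y k = -1 by exact: label_pm1.
have /andP[f0 f2] := f01.
have B0 : 0 <= B by have /andP[? ?] := lB 1 0 (or_introl erefl); lra.
have p01 : 0 <= p <= 2^-1.
  by rewrite mulr_ge0 ?subr_ge0 /= ?(ltW f0) //; [rewrite /p; nra|lra].
have [k [mE Nfk k2 kN]] := ceil_half_bounds N f01.
rewrite /m mE; clear m.
pose rad := trans_rademacher (HU U C) U p / (rho * f * (1 - f)).
pose dev := 9 * B * Num.sqrt (ln delta^-1) / ((1 - f) * Num.sqrt (N%:R * f)).
have goodE S : good S = (er l y (pair_scores U (w S)) (~: S)
    <= er l y (pair_scores U (w S)) S + rad + dev) by [].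
have f1 : 0 < 1 - f by lra.
have rad0 : 0 <= rad.
  apply: divr_ge0; first exact: trans_rademacher_ge0.
  by rewrite !mulr_ge0 ?(ltW f0) ?(ltW f1) ?(ltW rho0).
have dev0 : 0 <= dev by rewrite divr_ge0 // !mulr_ge0 ?sqrtr_ge0 ?(ltW f1).
have l0 j x : 0 <= l (y j) x by have /andP[] := lB (y j) x (y1 j).
have er0 g S : 0 <= er l y g S.
  by rewrite mulr_ge0 ?invr_ge0 // sumr_ge0.
set ngood := #|_|%:R; set all := #|_|%:R.
pose bad (S : {set 'I_N}) := (#|S| == k) && ~~ good S.
pose nbad : R := #|[set S : {set 'I_N} | bad S]|%:R.

have allE : all = ngood + nbad.
  rewrite -natrD; congr _%:R.
  rewrite -(cardsID [set S : {set 'I_N} | good S] [set S : {set 'I_N} | Posz #|S| == Posz k]).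
  congr (_ + _)%N.
    by apply: eq_card => S; rewrite !inE.
  by apply: eq_card => S; rewrite !inE andbC.
have all_bin : all = 'C(N, k)%:R.
  by have := card_draws 'I_N k; rewrite card_ord => <-.
have all0 : 0 < all by rewrite all_bin ltr0n bin_gt0.
rewrite ler_pdivlMr //.
suff nbad_le : nbad <= delta * all by rewrite mulrBl mul1r; lra.
have nobad : (forall S : {set 'I_N}, #|S| = k -> good S) -> nbad <= delta * all.
  move=> gS; have -> : nbad = 0.
    rewrite /nbad; have -> : [set S : {set 'I_N} | bad S] = set0; last by rewrite cards0.
    apply/setP => S; rewrite !inE /bad.
    by case: eqP => //= /gS ->.
  by rewrite mulr_ge0 ?ltW.
(* For [delta >= 1] the claim is trivial; below 1 the logarithm is positive and its square root
   genuine. *)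
have [d1|d1] := lerP 1 delta.
  have : nbad <= all by rewrite allE lerDr.
  by move=> h; apply: le_trans h _; rewrite -[leLHS]mul1r ler_wpM2r // ltW.
(* With nothing unseen, which means [N <= 1], the left-hand error is an empty sum. *)
have [uE|u0] := posnP (N - k).
  apply: nobad => S Sk; rewrite goodE.
  have -> : ~: S = set0.
    by apply/eqP; rewrite -cards_eq0 cardsCs setCK card_ord Sk uE.
  by rewrite {1}/er big_set0 mulr0 !addr_ge0.
(* If [B = 0] all losses vanish; this case is set apart because the concentration bound needs
   [c > 0]. *)
have [BE|Bn0] := eqVneq B 0.
  apply: nobad => S Sk; rewrite goodE.
  rewrite {1}/er big1 ?mulr0 ?addr_ge0 // => j _.
  by have := lB (y j) (pair_scores U (w S) j) (y1 j); rewrite BE; lra.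
have N0 : (0 < N)%N := leq_trans u0 (leq_subr _ _).
have k2u := half_le_twice_rest k2 u0.
have Bpos : 0 < B by rewrite lt_neqAle eq_sym Bn0.
set u := (N - k)%N in u0.
have ku : (k + u)%N = N by rewrite subnKC.
have NR : 0 < N%:R :> R by rewrite ltr0n.
have Nf0 : 0 < N%:R * f by rewrite mulr_gt0.
have kR : 0 < k%:R :> R by apply: lt_le_trans Nfk.
have k0 : (0 < k)%N by rewrite -(ltr0n R).
have uR : 0 < u%:R :> R by rewrite ltr0n.
have /boolp.choice [a aP] : forall S : {set 'I_N}, exists b : 'I_N -> R,
    (forall j, 0 <= b j <= C) /\ w S = U *m \col_j (y j * b j).
  by move=> S; have [b bC wE] := prefrank_dual C0 (wmin S); exists b.
(* The family is indexed by all subsets and fixed before sampling, so [F S] dominates the gap of the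
   output trained on [S] itself. *)
pose L (t : {set 'I_N}) j := l (y j) (pair_scores U (w t) j).
have LB t j : 0 <= L t j <= B by exact: lB.
pose F (S : {set 'I_N}) := supp set0 L (signed_sample R k u S).
have gap : avg_ext F k set0 <= rad.
  apply: (expected_gap_le ku k0 u0 set0 f01 rho0 Nfk k2 (y := y) (a := a)).
  - by move=> j; case: (y1 j) => ->; rewrite ?normrN normr1.
  - by move=> t j; have [] := aP t.
  - move=> t1 t2 j; rewrite /L !pair_scoresE -(aP t1).2 -(aP t2).2; exact: lLip.
pose c := 3 * B / k%:R.
have c0 : 0 < c by rewrite divr_gt0 // mulr_gt0.
have F_lip (A : {set 'I_N}) i j : #|A|.+1 = k -> i \notin A -> j \notin A ->
    F (i |: A) - F (j |: A) <= c.
  move=> _ iA jA; apply: le_trans (gap_lipschitz _ _ _ LB iA jA) _.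
  have uk : u%:R^-1 <= 2 / k%:R :> R.
    by rewrite ler_pdivlMr // mulrC ler_pdivrMr // -natrM ler_nat.
  have -> : c = B * (k%:R^-1 + 2 / k%:R) by rewrite /c; field; rewrite gt_eqF.
  by rewrite ler_wpM2l // lerD2l.
have badP S : bad S -> avg_ext F k set0 + dev <= F S.
  move=> /andP[/eqP Sk]; rewrite goodE -ltNge => h.
  have := supp_ge set0 L (signed_sample R k u S) S.
  rewrite -(er_gap ku l y (pair_scores U (w S)) Sk) -/(F S); lra.
have kI : (k <= #|'I_N|)%N by rewrite card_ord.
have nbadE : nbad = avg_ext (fun S : {set 'I_N} => (bad S)%:R) k set0 * all.
  have := @avg_ext_sum R 'I_N (fun S : {set 'I_N} => (bad S)%:R) k set0.
  rewrite cards0 add0n setC0 cardsT card_ord all_bin => -> //.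
  rewrite /nbad -sumr_const big_mkcond [RHS]big_mkcond /=.
  apply: eq_bigr => S _; rewrite inE sub0set /= /bad.
  by case: (#|S| == k); case: (good S).
rewrite nbadE ler_wpM2r ?(ltW all0) //.
apply: le_trans (avg_ext_chernoff c0 F_lip kI k0 dev0 erefl badP) _.
have lnd : 0 < ln delta^-1 by rewrite ln_gt0 // invf_gt1.
rewrite -[leRHS]invrK -[delta^-1]lnK ?posrE ?invr_gt0 // -expRN ler_expR lerN2.
pose lg := ln delta^-1; rewrite -/lg in lnd *.
have dev2 : dev ^+ 2 = 81 * B ^+ 2 * lg / ((1 - f) ^+ 2 * (N%:R * f)).
  rewrite /dev -/lg !exprMn exprVn exprMn !sqr_sqrtr ?(ltW lnd) ?(ltW Nf0) //; ring.
rewrite dev2 /c.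
have -> : 81 * B ^+ 2 * lg / ((1 - f) ^+ 2 * (N%:R * f)) / (8 * k%:R * (3 * B / k%:R) ^+ 2)
    = lg * (81 / 72 * k%:R) / ((1 - f) ^+ 2 * (N%:R * f)).
  by field; rewrite !gt_eqF.
rewrite ler_pdivlMr ?mulr_gt0 ?exprn_gt0 // ler_pM2l //.
have sq1 : (1 - f) ^+ 2 <= 1 by apply: exprn_ile1; [exact: ltW | rewrite gerBl ltW].
apply: (@le_trans _ _ (1 * (N%:R * f))); first by apply: ler_wpM2r => //; exact: ltW.
by rewrite mul1r; lra.
Qed.
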